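(* (i) If $G$ is a connected graph, which is not a tree, with exactly two main eigenvalues, then there exists an infinite family of finite connected graphs, of unbounded diameter, each of which has exactly two main eigenvalues, these being the same two main eigenvalues as those of $G$. (ii) If $G$ is a connected $\delta$-harmonic graph, which is not a tree, then there exists an infinite family of finite connected $\delta$-harmonic graphs with unbounded diameter.
   Context: All graphs are finite and simple. An eigenvalue $\mu$ of the $(0,1)$-adjacency matrix $A$ of a graph is called a main eigenvalue if there exists an eigenvector of $A$ corresponding to $\mu$ that is not orthogonal to the all-ones vector $\mathbf{j}$. The number of main eigenvalues counts distinct eigenvalues. With $\mathbf{d}:=A\mathbf{j}$ the vector of valencies (degrees), a graph is called $\delta$-harmonic if $A\mathbf{d}=\delta\mathbf{d}$. A family of finite connected graphs has unbounded diameter if for every integer $N$ it contains a graph of diameter greater than $N$. *)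

(* Defs.v *)
From HB Require Import structures.
From mathcomp Require Import all_boot all_order all_algebra.
From mathcomp Require Import classical_sets functions cardinality reals.
Set Implicit Arguments.
Unset Strict Implicit.
Unset Printing Implicit Defensive.

Import Order.TTheory GRing.Theory Num.Theory.
Local Open Scope ring_scope.
Local Open Scope classical_set_scope.

Record sgraph := SGraph {
  vertex :> finType;
  adj : rel vertex;
  adj_sym : symmetric adj;
  adj_irr : irreflexive adj
}.

Definition connected_graph (G : sgraph) : Prop :=
  (0 < #|G|)%N /\ forall x y : G, connect (@adj G) x y.

(* ucycle also accepts the empty sequence and an edge traversed back and forth,
   so genuine graph cycles are those of length at least 3. *)
Definition is_tree (G : sgraph) : Prop :=
  connected_graph G /\
  ~ exists s : seq G, (2 < size s)%N /\ ucycle (@adj G) s.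

Definition isomorphic (G H : sgraph) : Prop :=
  exists2 f : G -> H, bijective f & forall x y : G, adj (f x) (f y) = adj x y.

(* The least length k of a walk from x to y.  A reachable vertex is reached by
   a path of length less than #|G|; if y is not reachable the value is #|G|. *)
Definition dist (G : sgraph) (x y : G) : nat :=
  find (fun k => [exists p : k.-tuple G, path (@adj G) x p && (last x p == y)])
       (iota 0 #|G|).

Definition diam (G : sgraph) : nat :=
  (\max_(x : G) \max_(y : G) dist x y)%N.

Definition adjmx (R : realType) (G : sgraph) : 'M[R]_#|G| :=
  \matrix_(i, j) (adj (enum_val i : G) (enum_val j))%:R.

Definition ones (R : realType) (G : sgraph) : 'cV[R]_#|G| := const_mx 1.

Definition valencies (R : realType) (G : sgraph) : 'cV[R]_#|G| :=
  adjmx R G *m ones R G.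

(* eigenspace consists of left eigenvectors; since adjmx is symmetric these
   are the (transposed) right eigenvectors. *)
Definition main_eigenvalues (R : realType) (G : sgraph) : set R :=
  [set mu | exists v : 'rV[R]_#|G|,
     [/\ v != 0, (v <= eigenspace (adjmx R G) mu)%MS & v *m ones R G != 0]].
Arguments main_eigenvalues R G : clear implicits.

Definition harmonic (R : realType) (delta : R) (G : sgraph) : Prop :=
  adjmx R G *m valencies R G = delta *: valencies R G.

(* An infinite family is given as a sequence of pairwise non-isomorphic
   graphs. *)
Definition infinite_family (F : nat -> sgraph) : Prop :=
  forall m n : nat, m <> n -> ~ isomorphic (F m) (F n).

Definition unbounded_diameter (F : nat -> sgraph) : Prop :=
  forall N : nat, exists n : nat, (N < diam (F n))%N.

(* Main.v *)
(** Since [G] is not a tree it has an edge [uv] which is not a bridge.  Take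
    [m] copies of [G] indexed cyclically, and replace the copies of [uv] by
    edges from [u] in copy [i] to [v] in copy [i + 1].  The resulting graph [H] covers [G]: if [P]
    is the incidence matrix of the projection, then [A_H P = P A_G], [P 1 = 1]
    and [P^T 1 = m 1], so main eigenvectors can be lifted along [P^T] and pushed
    down along [P], and harmonicity lifts.  Since [G - uv] is connected so is
    [H], and since each step moves by at most one copy the diameter of [H] is
    at least about [m / 2]. *)
Require Import Defs.
From HB Require Import structures.
From mathcomp Require Import all_boot all_order all_algebra.
From mathcomp Require Import classical_sets functions cardinality reals.
From mathcomp Require Import zify boolp.
Set Implicit Arguments.
Unset Strict Implicit.
Unset Printing Implicit Defensive.

Import Order.TTheory GRing.Theory Num.Theory.
Local Open Scope ring_scope.
Local Open Scope classical_set_scope.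

(** The bound [k <= #|H|] covers the default value [#|H|] that [dist] takes when [y] is unreachable;
    any smaller value is the length of an actual walk. *)
Lemma leq_dist (H : sgraph) (x y : H) k :
  (k <= #|H|)%N ->
  (forall s, path (@adj H) x s -> last x s = y -> (k <= size s)%N) ->
  (k <= dist x y)%N.
Proof.
move=> kH ks; rewrite leqNgt; apply/negP => dk.
have := dk; rewrite /dist; set P := (X in find X) => fk.
have fH : (find P (iota 0 #|H|) < #|H|)%N by apply: leq_trans fk kH.
have : has P (iota 0 #|H|) by rewrite has_find size_iota.
move=> /(nth_find 0%N); rewrite nth_iota // add0n.
move=> /existsP [s /andP [xs /eqP ys]].
by have := ks s xs ys; rewrite size_tuple leqNgt fk.
Qed.

Lemma adjmx_tr (R : realType) (K : sgraph) : (adjmx R K)^T = adjmx R K.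
Proof. by apply/matrixP => i j; rewrite !mxE adj_sym. Qed.

Lemma main_eigenvaluesP (R : realType) (K : sgraph) (mu : R) :
  main_eigenvalues R K mu <->
  exists v : 'rV[R]_#|K|, v *m adjmx R K = mu *: v /\ v *m ones R K != 0.
Proof.
split=> [[v [_ /eigenspaceP vA v1]]|[v [vA v1]]]; exists v => //.
split=> //; last exact/eigenspaceP.
by apply: contraNneq v1 => ->; rewrite mul0mx.
Qed.

(** * Spectral consequences of a covering map *)

Section Covering.

Variables (R : realType) (H G : sgraph) (p : H -> G).

Definition projmx : 'M[R]_(#|H|, #|G|) :=
  \matrix_(i, j) (p (enum_val i) == enum_val j)%:R.

Lemma projmx_ones : projmx *m ones R G = ones R H.
Proof.
apply/matrixP => i j; rewrite !mxE (bigD1 (enum_rank (p (enum_val i)))) //=.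
rewrite !mxE enum_rankK eqxx mul1r big1 ?addr0 // => k nk.
rewrite !mxE mulr1; case: eqP => // pk.
by rewrite pk enum_valK eqxx in nk.
Qed.

(** Covering condition: an edge at [p x] has exactly one lift at [x], and a non-edge has none, so
    [p] is also a homomorphism. *)
Hypothesis p_cover :
  forall x y, #|[set x' : H | adj x x' & p x' == y]%SET| = adj (p x) y.

(** At [(x, y)] the left side counts the neighbours of [x] over [y], while the right side is
    [adj (p x) y]. *)
Lemma adjmx_projmx : adjmx R H *m projmx = projmx *m adjmx R G.
Proof.
apply/matrixP => i j; rewrite !mxE.
rewrite [RHS](bigD1 (enum_rank (p (enum_val i)))) //= !mxE enum_rankK eqxx mul1r.
rewrite [X in _ + X]big1 => [|k nk]; last first.
  rewrite !mxE; case: eqP => [pk|]; last by rewrite mul0r.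
  by rewrite pk enum_valK eqxx in nk.
rewrite addr0 -p_cover -sum1dep_card natr_sum.
rewrite [RHS](reindex _ (onW_bij _ (@enum_val_bij H))) [RHS]big_mkcond /=.
apply: eq_bigr => k _; rewrite !mxE -natrM mulnb.
by case: (_ && _).
Qed.

Lemma harmonic_cover (delta : R) : harmonic delta G -> harmonic delta H.
Proof.
rewrite /harmonic => hG.
have -> : valencies R H = projmx *m valencies R G.
  by rewrite /valencies -projmx_ones !mulmxA adjmx_projmx.
by rewrite mulmxA adjmx_projmx -mulmxA hG -scalemxAr.
Qed.

Variable m : nat.
Hypothesis m_gt0 : (0 < m)%N.
Hypothesis p_fiber : forall y, #|[set x | p x == y]%SET| = m.

Lemma trmx_projmx_ones : projmx^T *m ones R H = m%:R *: ones R G.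
Proof.
apply/matrixP => i j; rewrite !mxE mulr1 -(p_fiber (enum_val i)).
rewrite -sum1dep_card natr_sum.
rewrite [RHS](reindex _ (onW_bij _ (@enum_val_bij H))) [RHS]big_mkcond /=.
by apply: eq_bigr => k _; rewrite !mxE mulr1; case: eqP.
Qed.

Lemma main_eigenvalues_cover : main_eigenvalues R H = main_eigenvalues R G.
Proof.
apply/seteqP; split=> mu /main_eigenvaluesP [v [vA v1]]; apply/main_eigenvaluesP.
  exists (v *m projmx); split; last by rewrite -mulmxA projmx_ones.
  by rewrite -mulmxA -adjmx_projmx mulmxA vA -scalemxAl.
exists (v *m projmx^T); split; last first.
  rewrite -mulmxA trmx_projmx_ones -scalemxAr scaler_eq0 negb_or v1.
  by rewrite pnatr_eq0 -lt0n m_gt0.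
(* Both adjacency matrices are symmetric, so transposing [adjmx_projmx] gives the intertwining
   relation for [projmx^T]. *)
rewrite -mulmxA -[adjmx R H]adjmx_tr -trmx_mul adjmx_projmx trmx_mul adjmx_tr.
by rewrite mulmxA vA -scalemxAl.
Qed.

End Covering.

(** * Derived graphs of voltage assignments *)

Section DerivedGraph.

Variables (G : sgraph) (V : finZmodType) (w : G -> G -> V).
Hypothesis wN : forall x y, w y x = - w x y.

(* [w] is a voltage assignment in the sense of Gross and Tucker. *)
Definition derived_adj : rel (G * V) :=
  fun a b => adj a.1 b.1 && (b.2 == a.2 + w a.1 b.1).

Lemma derived_adj_sym : symmetric derived_adj.
Proof.
move=> [x i] [y j]; rewrite /derived_adj /= adj_sym (wN x y).
by rewrite [in RHS]eq_sym subr_eq.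
Qed.

Lemma derived_adj_irr : irreflexive derived_adj.
Proof. by move=> [x i]; rewrite /derived_adj /= adj_irr. Qed.

Definition derived_graph := SGraph derived_adj_sym derived_adj_irr.

(** The voltage determines the second coordinate, so the only possible neighbour of [a] over [y] is
    [(y, a.2 + w a.1 y)]. *)
Lemma derived_graph_cover (a : derived_graph) (y : G) :
  #|[set b : derived_graph | adj a b & b.1 == y]%SET| = adj a.1 y.
Proof.
have [ay|nay] := boolP (adj a.1 y).
  rewrite /= -(cards1 (y, a.2 + w a.1 y)); apply: eq_card => -[z j].
  rewrite !inE /= /derived_adj /= xpair_eqE.
  by case: (eqVneq z y) => [->|]; rewrite ?ay ?andbT ?andbF.
apply: eq_card0 => -[z j]; rewrite !inE /= /derived_adj /=.
by case: (eqVneq z y) => [->|]; rewrite ?(negPf nay) ?andbF.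
Qed.

Lemma derived_graph_fiber (y : G) :
  #|[set b : derived_graph | b.1 == y]%SET| = #|V|.
Proof.
rewrite -cardsT -(card_imset [set: V]%SET (f := fun i => (y, i))) => [|i j []//].
apply: eq_card => -[z j]; rewrite !inE /=; apply/eqP/imsetP => [->|[k _ []//]].
by exists j.
Qed.

(** Edges of zero voltage are those whose lifts stay inside one layer. *)
Definition unlifted_adj : rel G := fun x y => adj x y && (w x y == 0).

Lemma unlifted_adj_sym : symmetric unlifted_adj.
Proof. by move=> x y; rewrite /unlifted_adj adj_sym (wN x y) oppr_eq0. Qed.

Lemma connect_layer (i : V) (x y : G) :
  connect unlifted_adj x y -> connect (@adj derived_graph) (x, i) (y, i).
Proof.
move=> /connectP [s xs ->] {y}; elim: s x xs => //= z s IHs x /andP [xz zs].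
apply: connect_trans (IHs _ zs); apply: connect1.
by rewrite /= /derived_adj /=; case/andP: xz => -> /eqP ->; rewrite addr0 eqxx.
Qed.

End DerivedGraph.

(** * The cyclic cover along an edge: connectedness and diameter *)

Section CyclicCover.

Variables (G : sgraph) (u v : G) (n : nat).

(** Writing the voltage as a difference makes it antisymmetric even when [u = v]. The index [n.+2]
    provides a ring structure in which [1] is nonzero. *)
Definition edge_voltage (x y : G) : 'I_n.+2 :=
  ((x == u) && (y == v))%:R - ((x == v) && (y == u))%:R.

Lemma edge_voltageN x y : edge_voltage y x = - edge_voltage x y.
Proof. by rewrite /edge_voltage opprB (andbC (x == u)) (andbC (x == v)). Qed.

Definition cyclic_cover : sgraph := derived_graph edge_voltageN.

Lemma edge_voltage_cases x y :
  [\/ edge_voltage x y = 0, edge_voltage x y = 1 | edge_voltage y x = 1].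
Proof.
rewrite (edge_voltageN x y) /edge_voltage.
case: (_ && _); case: (_ && _); rewrite ?subrr ?subr0 ?sub0r ?opprK.
- by constructor 1.
- by constructor 2.
- by constructor 3.
- by constructor 1.
Qed.

Lemma edge_voltage_notin x y : x != u -> y != u -> edge_voltage x y = 0.
Proof.
by move=> /negPf xu /negPf yu; rewrite /edge_voltage xu yu andbF subrr.
Qed.

Lemma connected_cyclic_cover :
  u != v -> adj u v -> connect (unlifted_adj edge_voltage) v u ->
  connected_graph G -> connected_graph cyclic_cover.
Proof.
move=> uv auv cvu [_ cG]; split.
  by apply/card_gt0P; exists (u, 0).
have csym := sym_connect_sym (unlifted_adj_sym edge_voltageN).
(* The edge [uv], the only one with nonzero voltage, is bypassed by the detour [cvu]. *)
have cG0 x y : connect (unlifted_adj edge_voltage) x y.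
  apply: (connect_sub _ (cG x y)) => {}x {}y axy.
  have [w0|w0] := eqVneq (edge_voltage x y) 0.
    by apply: connect1; rewrite /unlifted_adj axy w0 eqxx.
  move: w0; rewrite /edge_voltage.
  have [/andP [/eqP -> /eqP ->] _|_] := boolP ((x == u) && (y == v)).
    by rewrite csym.
  by have [/andP [/eqP -> /eqP ->]|_] := boolP ((x == v) && (y == u)); rewrite ?subrr ?eqxx.
(* To climb one layer, walk to [u] inside the layer, cross to [v] in the next one, and walk back to
   [x]. *)
have cS x i k : connect (@adj cyclic_cover) (x, i) (x, i + k%:R).
  elim: k => [|k IHk]; first by rewrite addr0 connect0.
  apply: connect_trans IHk _.
  apply: connect_trans (connect_layer edge_voltageN _ (cG0 x u)) _.
  apply: connect_trans (connect_layer edge_voltageN _ (cG0 v x)).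
  apply: connect1; rewrite /= /derived_adj /= auv /edge_voltage !eqxx /=.
  by rewrite (negPf uv) subr0 -natr1 addrA.
move=> [x i] [y j]; apply: connect_trans (connect_layer edge_voltageN i (cG0 x y)) _.
by have := cS y i (j - i); rewrite natr_Zp addrC subrK.
Qed.

(** This is the distance from [i] to [0] in a cycle of length [n.+2]. *)
Definition layer_height (i : 'I_n.+2) : nat := minn i (n.+2 - i).

Lemma layer_heightS (i : 'I_n.+2) :
  ((layer_height (i + 1)%R <= (layer_height i).+1) &&
   (layer_height i <= (layer_height (i + 1)%R).+1))%N.
Proof.
rewrite /layer_height /= modnDmr; have := ltn_ord i.
(* The first case is the wraparound from the last layer to layer [0]. *)
rewrite addn1 ltnS leq_eqVlt => /orP [/eqP ->|iltn]; first by rewrite modnn; lia.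
by rewrite modn_small; lia.
Qed.

Lemma path_layer_height (a : cyclic_cover) (s : seq cyclic_cover) :
  path (@adj cyclic_cover) a s ->
  (layer_height (last a s).2 <= layer_height a.2 + size s)%N.
Proof.
elim: s a => [|b s IHs] a /=; first by rewrite addn0.
move=> /andP [/andP [_ /eqP b2] /IHs] /leq_trans; apply.
rewrite addnS -addSn leq_add2r.
have [w0|w1|w1] := edge_voltage_cases a.1 b.1.
- by rewrite b2 w0 addr0.
- by rewrite b2 w1; case/andP: (layer_heightS a.2).
- have -> : a.2 = b.2 + 1 by rewrite -w1 b2 (edge_voltageN a.1) addrK.
  by case/andP: (layer_heightS b.2).
Qed.

Lemma card_cyclic_cover : #|cyclic_cover| = (#|G| * n.+2)%N.
Proof. by rewrite card_prod card_ord. Qed.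

Lemma diam_cyclic_cover : (n.+2./2 <= diam cyclic_cover)%N.
Proof.
(* A layer of maximal height. *)
pose h : 'I_n.+2 := inord n.+2./2.
have hE : h = n.+2./2 :> nat by rewrite inordK //; lia.
apply: leq_trans (leq_bigmax ((u, 0) : cyclic_cover)).
apply: leq_trans (leq_bigmax ((u, h) : cyclic_cover)).
apply: leq_dist => [|s us lus].
  rewrite card_cyclic_cover; have : (0 < #|G|)%N by apply/card_gt0P; exists u.
  by case: #|G| => // k _; rewrite mulSn; lia.
have := path_layer_height us; rewrite lus /layer_height /= hE min0n add0n.
by apply: leq_trans; lia.
Qed.

End CyclicCover.

(** Take [uv] to be the first edge of a cycle: the rest of the cycle leads from [v] back to [u]
    without using it. *)
Lemma nonbridge_edge_of_not_tree (G : sgraph) :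
  connected_graph G -> ~ is_tree G ->
  exists u v : G, [/\ u != v, adj u v &
    forall n, connect (unlifted_adj (@edge_voltage G u v n)) v u].
Proof.
move=> cG ntG; have [s []] :
    exists s : seq G, (2 < size s)%N /\ ucycle (@adj G) s.
  by apply: contrapT => nc; apply: ntG.
case: s => [|u [|v t]] // t_gt0.
rewrite /ucycle /= inE negb_or rcons_path => /andP [/and3P [auv vt tu]].
move=> /andP [/andP [uv ut] /andP [nvt _]].
exists u, v; split=> // n; apply/connectP; exists (rcons t u); last by rewrite last_rcons.
rewrite rcons_path; apply/andP; split.
  (* The stretch [v :: t] avoids [u], so all its edges have zero voltage. *)
  apply: (@sub_in_path _ (predC1 u) (@adj G)) vt; last first.
    rewrite /= eq_sym uv /=; apply/allP => x xt /=.
    by apply: contraNneq ut => <-.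
  by move=> x y xu yu axy; rewrite /unlifted_adj axy edge_voltage_notin.
(* Length at least 3 makes [t] nonempty, so the closing edge into [u] is not [vu]. *)
have ltv : last v t != v.
  by case: t t_gt0 nvt {vt tu ut} => //= y t _; apply: contraNneq => <-; rewrite mem_last.
by rewrite /unlifted_adj tu /edge_voltage (negPf ltv) (negPf uv) andbF subrr eqxx.
Qed.

Lemma cyclic_cover_family (G : sgraph) :
  connected_graph G -> ~ is_tree G ->
  exists F : nat -> sgraph,
    [/\ infinite_family F, unbounded_diameter F &
        forall n, connected_graph (F n) /\ exists2 p : F n -> G,
          forall x y, #|[set x' : F n | adj x x' & p x' == y]%SET| = adj (p x) y &
          forall y, #|[set x | p x == y]%SET| = n.+2].
Proof.
move=> cG ntG; have [u [v [uv auv cvu]]] := nonbridge_edge_of_not_tree cG ntG.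
exists (cyclic_cover u v); split=> [m n mn [f /bij_eq_card]|N|n].
(* The orders [#|G| * n.+2] are pairwise distinct. *)
- rewrite !card_cyclic_cover => /eqP; rewrite eqn_pmul2l ?eqSS; last by case: cG.
  by move/eqP.
(* With [n = N.*2] the bound [n.+2./2] equals [N.+1]. *)
- exists N.*2; apply: leq_trans (diam_cyclic_cover u v _).
  by rewrite /= doubleK.
split; first exact: connected_cyclic_cover.
exists fst; first exact: derived_graph_cover.
by move=> y; rewrite derived_graph_fiber card_ord.
Qed.

Theorem theorem4p1 (R : realType) :
  (forall G : sgraph,
     connected_graph G -> ~ is_tree G ->
     (main_eigenvalues R G #= `I_2)%card ->
     exists F : nat -> sgraph,
       [/\ infinite_family F, unbounded_diameter F &
           forall n : nat,
             [/\ connected_graph (F n), (main_eigenvalues R (F n) #= `I_2)%card &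
                 main_eigenvalues R (F n) = main_eigenvalues R G]])
  /\
  (forall (G : sgraph) (delta : R),
     connected_graph G -> ~ is_tree G -> harmonic delta G ->
     exists F : nat -> sgraph,
       [/\ infinite_family F, unbounded_diameter F &
           forall n : nat, connected_graph (F n) /\ harmonic delta (F n)]).
Proof.
split=> [G|G delta] cG ntG hG; have [F [Finf Fdiam Fcov]] := cyclic_cover_family cG ntG.
  exists F; split=> // n; have [cF [p p_cover p_fiber]] := Fcov n.
  by rewrite (main_eigenvalues_cover _ p_cover (ltn0Sn _) p_fiber).
exists F; split=> // n; have [cF [p p_cover _]] := Fcov n.
by split; last exact: harmonic_cover p_cover _ hG.
Qed.
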